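(* Let $S:\mathbb{R}^n\rightrightarrows\mathbb{R}^n$ be a set-valued operator, $X\subseteq\mathbb{R}^n$ a closed linear subspace, and $\gamma,\lambda_x,\lambda_y\in\mathbb{R}$. Suppose there are $\mu,\rho\in\mathbb{R}$, a solution $(x^\star,y^\star)\in\mathrm{link}_XS$ and a set $\mathcal{U}\subseteq\mathbb{R}^n\times\mathbb{R}^n$ with $(x^\star,y^\star)\in\mathcal{U}$ such that: (a) $[\mu]_-[\rho]_-<1$ and $S$ is $(\mu\Pi_{X^\perp},\rho\Pi_X)$-semimonotone at $(x^\star,y^\star)$ on $\mathcal{U}$; (b) $S$ is outer semicontinuous on $\mathcal{U}$; (c) $\gamma\in([\mu]_-,1/[\rho]_-)$, $\lambda_x\in(0,2(1+\gamma\rho))$ and $\lambda_y\in(0,2(1+\mu/\gamma))$; (d) there is $\varepsilon>0$ such that for every $$(x,y)\in\mathcal{W}:=\{(x,y)\in X\times X^\perp:\gamma\lambda_x^{-1}\|x-x^\star\|^2+\gamma^{-1}\lambda_y^{-1}\|y-y^\star\|^2\le\varepsilon^2\}$$ there exists $(\bar x,\bar y)\in X\times X^\perp$ with $\bigl(\bar x+\gamma^{-1}(y-\bar y),\ \bar y+\gamma(x-\bar x)\bigr)\in\mathrm{gph}\,S\cap\mathcal{U}$. Let $(x^0,y^0)\in\mathcal{W}$ and let $(\bar x^k,\bar y^k,x^k,y^k)_{k\in\mathbb{N}}$ be any sequence generated by the rule: find $\bar x^k\in X$ and $\bar y^k\in X^\perp$ such that $\bigl(\bar x^k+\gamma^{-1}(y^k-\bar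 y^k),\ \bar y^k+\gamma(x^k-\bar x^k)\bigr)\in\mathrm{gph}\,S\cap\mathcal{U}$, and set $$x^{k+1}=x^k+\lambda_x(\bar x^k-x^k),\qquad y^{k+1}=y^k+\lambda_y(\bar y^k-y^k).$$ Then either a point $(\bar x^k,\bar y^k)\in\mathcal{W}\cap\mathrm{link}_XS$ is reached in a finite number of iterations, or the following hold. (i) $(x^k,y^k)\in\mathcal{W}$ for all $k\in\mathbb{N}$, since the sequence $\bigl(\gamma\lambda_x^{-1}\|x^k-x^\star\|^2+\gamma^{-1}\lambda_y^{-1}\|y^k-y^\star\|^2\bigr)_{k\in\mathbb{N}}$ is nonincreasing. (ii) Let $\bar\alpha:=\min\bigl(\tfrac{1+\gamma\rho}{\lambda_x},\tfrac{1+\mu/\gamma}{\lambda_y}\bigr)>\tfrac12$. For every $N\in\mathbb{N}$, $$\min_{k=0,\dots,N}\Bigl(\gamma\lambda_x\|\bar x^k-x^k\|^2+\gamma^{-1}\lambda_y\|\bar y^k-y^k\|^2\Bigr)\le\frac{\gamma\lambda_x^{-1}\|x^0-x^\star\|^2+\gamma^{-1}\lambda_y^{-1}\|y^0-y^\star\|^2}{(N+1)(2\bar\alpha-1)}.$$ Additionally, if $S$ is $(\mu\Pi_{X^\perp},\rho\Pi_X)$-semimonotone on $\mathcal{U}$, then the sequence $\bigl(\gamma\lambda_x\|\bar x^k-x^k\|^2+\gamma^{-1}\lambda_y\|\bar y^k-y^k\|^2\bigr)_k$ is nonincreasing, and the minimum above is therefore attained at $k=N$. (iii) The sequences $(x^k,y^k)_k$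 and $(\bar x^k,\bar y^k)_k$ are bounded and their limit points belong to $\mathcal{W}\cap\mathrm{link}_XS$. (iv) If $\{(x^\star,y^\star)\}=\mathcal{W}\cap\mathrm{link}_XS$, then the sequences $(x^k,y^k)_k$ and $(\bar x^k,\bar y^k)_k$ converge to some element of $\mathcal{W}\cap\mathrm{link}_XS$.
   Context: $\Pi_X,\Pi_{X^\perp}$ are the orthogonal projections onto $X$ and $X^\perp$; $[t]_-=-\min\{0,t\}$, with $1/0=+\infty$. $\mathrm{gph}\,S=\{(x,y):y\in S(x)\}$. $\mathrm{link}_XS$ is the set of all pairs $(x,y)$ with $x\in X$, $y\in X^\perp$, $y\in S(x)$. For symmetric matrices $M,R$, an operator $T$ is $(M,R)$-semimonotone at $(x',y')\in\mathrm{gph}\,T$ on a set $\mathcal{U}\ni(x',y')$ if $\langle x-x',y-y'\rangle\ge\langle x-x',M(x-x')\rangle+\langle y-y',R(y-y')\rangle$ for all $(x,y)\in\mathrm{gph}\,T\cap\mathcal{U}$; it is $(M,R)$-semimonotone on $\mathcal{U}$ if this holds at every $(x',y')\in\mathrm{gph}\,T\cap\mathcal{U}$. $S$ is outer semicontinuous on $\mathcal{U}$ if, whenever $(x^k,y^k)\in\mathrm{gph}\,S\cap\mathcal{U}$ and $(x^k,y^k)\to(\bar x,\bar y)$, one has $\bar y\in S(\bar x)$. *)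

(* Defs.v *)
From HB Require Import structures.
From mathcomp Require Import all_boot all_order all_algebra.
From mathcomp Require Import all_classical all_reals all_analysis.
Set Implicit Arguments.
Unset Strict Implicit.
Unset Printing Implicit Defensive.
Import Order.TTheory GRing.Theory Num.Theory.
Import numFieldNormedType.Exports.
Local Open Scope classical_set_scope.
Local Open Scope ring_scope.

(* R^n is 'rV[R]_n, so that a matrix M acts on a vector x by x *m M.
   The canonical norm of 'rV[R]_n is the sup norm; it is used here only for
   the topology and for boundedness, where the choice of norm is immaterial.
   Lengths are measured by the Euclidean norm enorm. *)

Definition dot (R : realType) (n : nat) (u v : 'rV[R]_n) : R :=
  (u *m v^T) 0 0.

Section DotInstances.
Variables (R : realType) (n : nat).

Fact dot_is_bilinear : bilinear_for
  (GRing.Scale.Law.clone _ _ *%R _) (GRing.Scale.Law.clone _ _ (idfun \; *%R) _)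
  (@dot R n).
Proof.
split=> [v|u] a x y; rewrite /dot /=.
  by rewrite mulmxDl -scalemxAl !mxE.
by rewrite linearP mulmxDr -scalemxAr !mxE.
Qed.

HB.instance Definition _ := bilinear_isBilinear.Build R 'rV[R]_n 'rV[R]_n R
  _ _ (@dot R n) dot_is_bilinear.

Fact dot_is_symmetric (x y : 'rV[R]_n) :
  dot x y = (-1) ^+ false * idfun (dot y x).
Proof. by rewrite mul1r /dot /= -[x *m _]trmxK mxE trmx_mul trmxK. Qed.

HB.instance Definition _ :=
  isHermitianSesquilinear.Build R 'rV[R]_n false idfun (@dot R n)
    dot_is_symmetric.

Fact dot_is_definite (u : 'rV[R]_n) : u != 0 -> 0 < dot u u.
Proof.
move=> /rV0Pn[i ui0]; rewrite /dot mxE (bigD1 i)//= mxE.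
apply: ltr_wpDr; last by rewrite -expr2 exprn_even_gt0.
by apply: sumr_ge0 => j _; rewrite mxE -expr2 sqr_ge0.
Qed.

HB.instance Definition _ :=
  isDotProduct.Build R 'rV[R]_n (@dot R n) dot_is_definite.

End DotInstances.

Section ProgressiveDecoupling.
Variables (R : realType) (n : nat).
Local Notation V := 'rV[R]_n.
Implicit Types (S : V -> set V) (X : {vspace V}) (U : set (V * V)).

Definition enorm (u : V) : R := Num.sqrt (dot u u).

Definition perp X : {vspace V} := orthov (@dot R n) X.

Definition orthproj X : 'M[R]_n := lin1_mx (daddv_pi X (perp X)).

Definition negpart (t : R) : R := - Num.min 0 t.

Definition gph S : set (V * V) := [set p | S p.1 p.2].

Definition link X S : set (V * V) :=
  [set p | [/\ p.1 \in X, p.2 \in perp X & S p.1 p.2]].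

(* Meant for symmetric A and B, and for p' in gph S `&` U. *)
Definition semimonotone_at (A B : 'M[R]_n) S (p' : V * V) U : Prop :=
  forall p : V * V, (gph S `&` U) p ->
    dot (p.1 - p'.1) ((p.1 - p'.1) *m A) + dot (p.2 - p'.2) ((p.2 - p'.2) *m B)
      <= dot (p.1 - p'.1) (p.2 - p'.2).

Definition semimonotone_on (A B : 'M[R]_n) S U : Prop :=
  forall p', (gph S `&` U) p' -> semimonotone_at A B S p' U.

Definition outer_semicontinuous_on S U : Prop :=
  forall (p : nat -> V * V) (pbar : V * V),
    (forall k, (gph S `&` U) (p k)) -> p k @[k --> \oo] --> pbar ->
    S pbar.1 pbar.2.

Definition wdist2 (gamma lx ly : R) (p q : V * V) : R :=
  gamma * lx^-1 * enorm (p.1 - q.1) ^+ 2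
  + gamma^-1 * ly^-1 * enorm (p.2 - q.2) ^+ 2.

Definition residual (gamma lx ly : R) (pbar p : V * V) : R :=
  gamma * lx * enorm (pbar.1 - p.1) ^+ 2
  + gamma^-1 * ly * enorm (pbar.2 - p.2) ^+ 2.

Definition nbhdW X (gamma lx ly eps : R) (pstar : V * V) : set (V * V) :=
  [set p | [/\ p.1 \in X, p.2 \in perp X
             & wdist2 gamma lx ly p pstar <= eps ^+ 2]].

(* pbar solves the inclusion of the progressive decoupling step at p. *)
Definition pd_solution S X U (gamma : R) (p pbar : V * V) : Prop :=
  [/\ pbar.1 \in X, pbar.2 \in perp X
    & (gph S `&` U) (pbar.1 + gamma^-1 *: (p.2 - pbar.2),
                     pbar.2 + gamma *: (p.1 - pbar.1))].

Lemma mem_perpP X (v : V) :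
  reflect {in X, forall u, dot v u = 0} (v \in perp X).
Proof. exact: mem_orthovP. Qed.

Lemma capv_perp X : (X :&: perp X = 0)%VS.
Proof.
apply/eqP; rewrite -subv0; apply/subvP => u; rewrite memv_cap memv0.
move=> /andP[uX /mem_perpP/(_ u uX) uu0]; apply: contraT => /dot_is_definite.
by rewrite uu0 ltxx.
Qed.

Lemma addv_perp X : (X + perp X = fullv)%VS.
Proof.
have dim_cap (s : seq V) :
    (n <= \dim (\bigcap_(u <- s) orthov (@dot R n) <[u]>) + size s)%N.
  elim: s => [|u s IHs]; first by rewrite big_nil addn0 dimvf /dim /= ?mul1n.
  rewrite big_cons capvC /= addnS -addSn; apply: leq_trans IHs _.
  rewrite leq_add2r; apply: leq_trans (leqSpred _) _; rewrite ltnS.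
  exact: leq_dim_orthov1.
apply/eqP; rewrite eqEdim subvf/= dimv_disjoint_sum ?capv_perp//.
rewrite dimvf /dim /= ?mul1n addnC; apply: leq_trans (dim_cap (vbasis X)) _.
rewrite size_tuple leq_add2r; apply: dimvS; rewrite /perp /orthov.
rewrite (big_nth 0) size_tuple big_mkord; apply/subv_bigcapP => i _.
by rewrite -orthov1E (bigcapv_inf i).
Qed.

Lemma mulmx_orthproj X (v : V) : v *m orthproj X = daddv_pi X (perp X) v.
Proof. exact: mul_rV_lin1. Qed.

Lemma mem_orthproj X (v : V) : v *m orthproj X \in X.
Proof. by rewrite mulmx_orthproj memv_pi. Qed.

Lemma mem_sub_orthproj X (v : V) : v - v *m orthproj X \in perp X.
Proof.
rewrite mulmx_orthproj -{1}[v](daddv_pi_add (capv_perp X)) ?addv_perp ?memvf//.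
by rewrite addrC addKr memv_pi.
Qed.

Lemma tr_orthproj X : (orthproj X)^T = orthproj X.
Proof.
have H u v : dot u (v *m orthproj X) = dot (u *m orthproj X) (v *m orthproj X).
  apply/eqP; rewrite -subr_eq0 -linearBl; apply/eqP.
  exact: (mem_perpP _ _ (mem_sub_orthproj X u) _ (mem_orthproj X v)).
have dotC u v : dot u v = dot v u :> R by rewrite dot_is_symmetric mul1r.
have dotE (A : 'M[R]_n) i j : dot (delta_mx 0 i) (delta_mx 0 j *m A) = A j i.
  by rewrite dotC /dot trmx_delta -rowE -colE !mxE.
by apply/matrixP => i j; rewrite mxE -!dotE H dotC -H.
Qed.

End ProgressiveDecoupling.

(* Main.v *)
Require Import Defs.
From mathcomp Require Import all_boot all_order all_algebra.
From mathcomp Require Import all_classical all_reals all_analysis.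
From mathcomp Require Import ring lra.
Set Implicit Arguments.
Unset Strict Implicit.
Unset Printing Implicit Defensive.
Import Order.TTheory GRing.Theory Num.Theory.
Import numFieldNormedType.Exports.
Local Open Scope classical_set_scope.
Local Open Scope ring_scope.

(** The point of gph S selected at step k differs from a reference point by a
    vector (a - b' / gamma, b - gamma a') with a, a' in X and b, b' in its
    orthogonal complement, so semimonotonicity bounds
    gamma <a, a'> + <b, b'> / gamma by a combination of |a'|^2 and |b'|^2.
    With the reference point (xstar, ystar) this makes the weighted squared
    distance to the solution drop by at least (2 alphabar - 1) times the
    residual; with the selected point of another step as reference it makes the
    residual nonincreasing. The residuals are then summable, so
    (xbar k, ybar k) - (x k, y k) tends to 0, the selected points and the
    iterates share their limit points, and outer semicontinuity applies. A
    bounded sequence of R^n x R^n with a single limit point converges. *)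

(** For each [j], clustering yields an index [k >= j] with [u k] within [1/(j+1)] of [p]. The
    resulting [phi] need not be monotone; the limit arguments only use that it tends to infinity. *)
Lemma cluster_cvg_subseq (R : realType) (T : pseudoMetricType R)
    (u : nat -> T) (p : T) :
  cluster (u k @[k --> \oo]) p ->
  exists2 phi : nat -> nat, phi k @[k --> \oo] --> \oo
    & u (phi k) @[k --> \oo] --> p.
Proof.
move=> clp.
have /choice[phi phiP] (j : nat) :
    exists k, (j <= k)%N /\ ball p (j.+1%:R^-1) (u k).
  have [||_ [[k jk <-] pk]] := clp (u @` [set k | (j <= k)%N])
      (ball p j.+1%:R^-1).
  - by exists j => // k jk; exists k.
  - by apply: nbhsx_ballx; rewrite invr_gt0.
  - by exists k.
exists phi.
  move=> A [m _ mA]; exists m => // k /= mk; apply: mA => /=.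
  by apply: leq_trans mk _; case: (phiP k).
apply/cvg_ballP => e e0; near=> k.
have [_] := phiP k; apply: le_ball; apply: ltW.
by near: k; exact: near_infty_natSinv_lt (PosNum e0).
Unshelve. all: end_near. Qed.

(** * Euclidean inner product against the sup-norm topology *)

Section Dot.
Variables (R : realType) (n : nat).
Local Notation V := 'rV[R]_n.
Implicit Types (u v w : V) (X : {vspace V}).

Lemma dotC u v : dot u v = dot v u.
Proof. by rewrite dot_is_symmetric mul1r. Qed.

Lemma dotDl u v w : dot (u + v) w = dot u w + dot v w.
Proof. exact: linearDl. Qed.

Lemma dotDr u v w : dot u (v + w) = dot u v + dot u w.
Proof. exact: linearDr. Qed.

Lemma dotNl u v : dot (- u) v = - dot u v.
Proof. exact: linearNl. Qed.

Lemma dotNr u v : dot u (- v) = - dot u v.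
Proof. exact: linearNr. Qed.

Lemma dotZl c u v : dot (c *: u) v = c * dot u v.
Proof. exact: (linearZl_LR (@dot R n)). Qed.

Lemma dotZr c u v : dot u (c *: v) = c * dot u v.
Proof. exact: (linearZr_LR (@dot R n)). Qed.

Definition dotE := (dotDl, dotDr, dotNl, dotNr, dotZl, dotZr).

Lemma dot_sum u v : dot u v = \sum_i u 0 i * v 0 i.
Proof. by rewrite /dot mxE; apply: eq_bigr => i _; rewrite mxE. Qed.

Lemma dot_ge0 u : 0 <= dot u u.
Proof. by rewrite dot_sum sumr_ge0// => i _; rewrite -expr2 sqr_ge0. Qed.

Lemma enorm_sqr u : enorm u ^+ 2 = dot u u.
Proof. by rewrite /enorm sqr_sqrtr ?dot_ge0. Qed.

(** One squared coordinate is at most the sum of all. This carries Euclidean estimates over to the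
    norm that defines the topology. *)
Lemma norm_le_enorm u : `|u| <= enorm u.
Proof.
rewrite [leLHS]/Num.norm /= mx_normrE; apply: bigmax_le => [|[i j] _].
  exact: sqrtr_ge0.
rewrite /= (ord1 i) -sqrtr_sqr; apply: ler_wsqrtr.
rewrite dot_sum (bigD1 j)//= expr2 lerDl sumr_ge0// => k _.
by rewrite -expr2 sqr_ge0.
Qed.

Lemma cvg_dot (T : Type) (F : set_system T) (FF : Filter F) (f g : T -> V) u v :
  f t @[t --> F] --> u -> g t @[t --> F] --> v ->
  dot (f t) (g t) @[t --> F] --> dot u v.
Proof.
move=> fu gv; rewrite dot_sum.
under eq_fun do rewrite dot_sum.
apply: cvg_big => [|i _]; first exact: (@add_continuous R^o).
have coord (h : T -> V) w :
    h t @[t --> F] --> w -> h t 0 i @[t --> F] --> w 0 i.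
  move=> hw; apply: (@cvg_comp _ _ _ h (fun u : V => u 0 i) _ (nbhs w)) => //.
  exact: coord_continuous.
by apply: cvgM; exact: coord.
Qed.

Lemma enorm_sqr_cvg0 (f : nat -> V) :
  enorm (f k) ^+ 2 @[k --> \oo] --> 0 ->
  f k @[k --> \oo] --> (0 : V).
Proof.
move=> f0; apply: norm_cvg0; apply: (@squeeze_cvgr _ _ _ _ (cst 0)
    (fun k => Num.sqrt (enorm (f k) ^+ 2))); last 2 first.
- exact: cvg_cst.
- have := @sqrt_continuous R 0; rewrite /continuous_at sqrtr0.
  exact: cvg_comp f0.
- near=> k; rewrite normr_ge0 sqrtr_sqr/=.
  by rewrite (le_trans (norm_le_enorm _))// ler_norm.
Unshelve. all: end_near. Qed.

(** * Orthogonal complements, their projections and their closedness *)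

Lemma dot_mem_perp X u v : u \in X -> v \in perp X -> dot u v = 0.
Proof. by move=> uX /mem_perpP vX; rewrite dotC vX. Qed.

Lemma subv_perp_perp X : (X <= perp (perp X))%VS.
Proof.
by apply/subvP => u uX; apply/mem_perpP => v vX; exact: dot_mem_perp vX.
Qed.

(** The difference of the two sides lies in [X] and in [perp X], which meet only in 0. *)
Lemma mulmx_orthprojDE X u v :
  u \in X -> v \in perp X -> (u + v) *m orthproj X = u.
Proof.
move=> uX vX; apply/eqP; rewrite -subr_eq0 -memv0 -(capv_perp X) memv_cap.
rewrite memvB ?mem_orthproj//= -memvN opprB.
have -> : u - (u + v) *m orthproj X = ((u + v) - (u + v) *m orthproj X) - v.
  by rewrite [RHS]addrAC addrK.
by rewrite memvB ?mem_sub_orthproj.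
Qed.

Lemma mulmx_orthproj_perpDE X u v :
  u \in X -> v \in perp X -> (u + v) *m orthproj (perp X) = v.
Proof.
move=> uX vX; rewrite addrC mulmx_orthprojDE//.
exact: subvP (subv_perp_perp X) _ uX.
Qed.

(** [perp X] is cut out by equations [dot u v = 0], each of which passes to the limit. *)
Lemma perp_limit X (T : Type) (F : set_system T) (FF : ProperFilter F)
    (f : T -> V) u :
  (forall t, f t \in perp X) -> f t @[t --> F] --> u -> u \in perp X.
Proof.
move=> fX fu; apply/mem_perpP => v vX.
have : dot (f t) v @[t --> F] --> dot u v.
  by apply: cvg_dot => //; exact: cvg_cst.
have -> : (fun t => dot (f t) v) = cst 0.
  by apply/funext => t; rewrite dotC (dot_mem_perp vX).
by move=> /(cvg_lim (@Rhausdorff R)) <-; rewrite lim_cst.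
Qed.

(** For [u] in the double complement, [u] minus its projection lies in [perp X] and in
    [perp (perp X)], hence vanishes. So [X] is itself a complement, and closedness of complements
    applies to it. *)
Lemma perp_perp X : perp (perp X) = X.
Proof.
apply/eqP; rewrite eqEsubv subv_perp_perp andbT; apply/subvP => u uX.
have : u - u *m orthproj X \in (perp X :&: perp (perp X))%VS.
  rewrite memv_cap mem_sub_orthproj memvB//.
  exact: subvP (subv_perp_perp X) _ (mem_orthproj X u).
by rewrite capv_perp memv0 subr_eq0 => /eqP ->; exact: mem_orthproj.
Qed.

Lemma limit_memv X (T : Type) (F : set_system T) (FF : ProperFilter F)
    (f : T -> V) u :
  (forall t, f t \in X) -> f t @[t --> F] --> u -> u \in X.
Proof.
move=> fX fu; rewrite -[X]perp_perp; apply: perp_limit fu => t.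
by rewrite perp_perp.
Qed.

End Dot.

(** * Estimates for one step of the method *)

Section ProgressiveDecoupling.
Variables (R : realType) (n : nat).
Local Notation V := 'rV[R]_n.
Variables (S : V -> set V) (X : {vspace V}) (U : set (V * V)).
Variables (gamma lx ly mu rho : R).
Hypotheses (gamma_gt0 : 0 < gamma) (lx_gt0 : 0 < lx) (ly_gt0 : 0 < ly).
Implicit Types p q : V * V.

(** By orthogonality [dot u v] reduces to [- gamma <a,a'> - <b,b'> / gamma]. The [perp X] part of
    [u] is [- b' / gamma] and the [X] part of [v] is [- gamma a'], so the quadratic terms involve
    only [|a'|^2] and [|b'|^2]. *)
Lemma semimonotone_parts (a a' b b' : V) :
  a \in X -> a' \in X -> b \in perp X -> b' \in perp X ->
  let u := a - gamma^-1 *: b' in let v := b - gamma *: a' in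
  dot u (u *m (mu *: orthproj (perp X))) + dot v (v *m (rho *: orthproj X))
    <= dot u v ->
  gamma * dot a a' + gamma^-1 * dot b b'
    <= - (gamma * (gamma * rho) * dot a' a'
          + gamma^-1 * (mu / gamma) * dot b' b').
Proof.
move=> aX a'X bX b'X u v.
(* The [X] component goes first, as [mulmx_orthprojDE] expects. *)
have -> : v = - (gamma *: a') + b by rewrite addrC.
rewrite -!scalemxAr mulmx_orthproj_perpDE ?memvN ?memvZ//.
rewrite mulmx_orthprojDE ?memvN ?memvZ//.
have [ba ba'] : dot b a = 0 /\ dot b a' = 0.
  by split; rewrite dotC; exact: dot_mem_perp bX.
have [ab' a'b'] : dot a b' = 0 /\ dot a' b' = 0.
  by split; exact: dot_mem_perp b'X.
have ab : dot a b = 0 by exact: dot_mem_perp bX.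
rewrite /u !dotE (dotC b' b) (dotC b' a') ba' ab ab' a'b'.
have g1 : gamma^-1 * gamma = 1 by rewrite mulVf// gt_eqF.
set g := gamma^-1 in g1 *.
rewrite !(mulr0, mulrN, mulNr, oppr0, addr0, add0r, opprK).
rewrite -opprD lerNr !(mulrA _ g) => h.
nra.
Qed.

Definition relax p pbar : V * V :=
  (p.1 + lx *: (pbar.1 - p.1), p.2 + ly *: (pbar.2 - p.2)).

(** [semimonotone_parts] is applied with [a = xb - xs], [a' = xb - x], and likewise in [y]. Since
    [a = (x - xs) + a'], it bounds the cross terms by [-(1 + gamma rho)] and [-(1 + mu / gamma)]
    times the weighted squares, hence by [- alpha] times the residual. *)
Lemma wdist2_relax alpha p pbar q :
  alpha * lx <= 1 + gamma * rho -> alpha * ly <= 1 + mu / gamma ->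
  link X S q -> p.1 \in X -> p.2 \in perp X ->
  semimonotone_at (mu *: orthproj (perp X)) (rho *: orthproj X) S q U ->
  pd_solution S X U gamma p pbar ->
  wdist2 gamma lx ly (relax p pbar) q
    <= wdist2 gamma lx ly p q
       - (2 * alpha - 1) * residual gamma lx ly pbar p.
Proof.
case: p pbar q => x y [xb yb] [xs ys] /= alx aly [/= xsX ysX _] xX yX mono.
case=> /= xbX ybX /mono /=.
have -> : xb + gamma^-1 *: (y - yb) - xs = (xb - xs) - gamma^-1 *: (yb - y).
  by rewrite -[y - yb]opprB scalerN addrAC.
have -> : yb + gamma *: (x - xb) - ys = (yb - ys) - gamma *: (xb - x).
  by rewrite -[x - xb]opprB scalerN addrAC.
move=> /semimonotone_parts; rewrite !memvB// => /(_ isT isT isT isT).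
have -> : xb - xs = (x - xs) + (xb - x) by rewrite [RHS]addrC subrKA.
have -> : yb - ys = (y - ys) + (yb - y) by rewrite [RHS]addrC subrKA.
rewrite /wdist2 /residual /relax !enorm_sqr /=.
rewrite (addrAC x (lx *: _)) (addrAC y (ly *: _)).
have := dot_ge0 (xb - x); have := dot_ge0 (yb - y).
move: (x - xs) (xb - x) (y - ys) (yb - y) => e d f h; rewrite !dotE.
rewrite (dotC d e) (dotC h f).
move: (dot e e) (dot e d) (dot d d) (dot f f) (dot f h) (dot h h).
move=> E P D E' P' D' D'0 D0 H.
(* The weight [1 / lx] makes the cross term independent of [lx], matching the bound [H]. *)
have -> : gamma * lx^-1 * (E + lx * P + lx * (P + lx * D)) =
    gamma * lx^-1 * E + 2 * gamma * P + gamma * lx * D.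
  by field; rewrite gt_eqF.
have -> : gamma^-1 * ly^-1 * (E' + ly * P' + ly * (P' + ly * D')) =
    gamma^-1 * ly^-1 * E' + 2 * gamma^-1 * P' + gamma^-1 * ly * D'.
  by field; rewrite !gt_eqF.
have gD0 : 0 <= gamma * D by rewrite mulr_ge0// ltW.
have gD'0 : 0 <= gamma^-1 * D' by rewrite mulr_ge0// invr_ge0 ltW.
have := ler_wpM2r gD0 alx; have := ler_wpM2r gD'0 aly.
lra.
Qed.

(** Comparing two consecutive selected points, [a'] is the change [e] of the displacement
    [d = xb - x], and [a = lx d + e]. The cross terms in the expansion of [|d + e|^2] are then
    negative enough to absorb [|e|^2], because [lx <= 2 (1 + gamma rho)]; likewise in [y]. *)
Lemma residual_relax p pbar qbar :
  lx <= 2 * (1 + gamma * rho) -> ly <= 2 * (1 + mu / gamma) ->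
  semimonotone_on (mu *: orthproj (perp X)) (rho *: orthproj X) S U ->
  p.1 \in X -> p.2 \in perp X ->
  pd_solution S X U gamma p pbar ->
  pd_solution S X U gamma (relax p pbar) qbar ->
  residual gamma lx ly qbar (relax p pbar) <= residual gamma lx ly pbar p.
Proof.
case: p pbar qbar => x y [xb yb] [xc yc] /= hlx hly mono xX yX.
case=> /= xbX ybX /mono{}mono; case=> /= xcX ycX /mono /=.
rewrite /residual /relax !enorm_sqr /=.
set x' := x + _; set y' := y + _.
have x'X : x' \in X by rewrite memvD ?memvZ ?memvB.
have y'X : y' \in perp X by rewrite memvD ?memvZ ?memvB.
have -> : xc + gamma^-1 *: (y' - yc) - (xb + gamma^-1 *: (y - yb)) =
    (xc - xb) - gamma^-1 *: ((yc - y') - (yb - y)).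
  by apply/rowP => i; rewrite !mxE; ring.
have -> : yc + gamma *: (x' - xc) - (yb + gamma *: (x - xb)) =
    (yc - yb) - gamma *: ((xc - x') - (xb - x)).
  by apply/rowP => i; rewrite !mxE; ring.
move=> /semimonotone_parts; rewrite !memvB// => /(_ isT isT isT isT).
have -> : xc - xb = lx *: (xb - x) + (xc - x' - (xb - x)).
  by apply/rowP => i; rewrite !mxE; ring.
have -> : yc - yb = ly *: (yb - y) + (yc - y' - (yb - y)).
  by apply/rowP => i; rewrite !mxE; ring.
move=> H.
have -> : xc - x' = (xb - x) + (xc - x' - (xb - x)).
  by rewrite [RHS]addrC subrK.
have -> : yc - y' = (yb - y) + (yc - y' - (yb - y)).
  by rewrite [RHS]addrC subrK.
move: H.
have := dot_ge0 (xc - x' - (xb - x)); have := dot_ge0 (yc - y' - (yb - y)).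
move: (xc - x' - _) (yc - y' - _) => e f.
move: (xb - x) (yb - y) => d h; rewrite !dotE.
rewrite (dotC e d) (dotC f h).
move: (dot e e) (dot d e) (dot d d) (dot f f) (dot h f) (dot h h).
move=> E P D E' P' D' E'0 E0 H.
have gE0 : 0 <= gamma * E by rewrite mulr_ge0// ltW.
have gE'0 : 0 <= gamma^-1 * E' by rewrite mulr_ge0// invr_ge0 ltW.
have := ler_wpM2r gE0 hlx; have := ler_wpM2r gE'0 hly.
lra.
Qed.

(** * Nonnegativity, boundedness and passage to the limit *)

Lemma wdist2_ge0 p q : 0 <= wdist2 gamma lx ly p q.
Proof.
by apply: addr_ge0; rewrite mulr_ge0 ?sqr_ge0// mulr_ge0 ?invr_ge0// ltW.
Qed.

Lemma residual_ge0 p q : 0 <= residual gamma lx ly p q.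
Proof.
by apply: addr_ge0; rewrite mulr_ge0 ?sqr_ge0// mulr_ge0 ?invr_ge0// ltW.
Qed.

(** Each weighted square is at most [eps^2], and the norm of a pair is the larger of the two
    norms. *)
Lemma nbhdW_bounded eps pstar :
  exists M, forall p, nbhdW X gamma lx ly eps pstar p -> `|p - pstar| <= M.
Proof.
exists (Num.max (Num.sqrt (eps ^+ 2 / (gamma * lx^-1)))
                (Num.sqrt (eps ^+ 2 / (gamma^-1 * ly^-1)))) => p [_ _].
rewrite /wdist2 => pW.
have gl0 : 0 < gamma * lx^-1 by rewrite mulr_gt0 ?invr_gt0.
have gl0' : 0 < gamma^-1 * ly^-1 by rewrite mulr_gt0 ?invr_gt0.
rewrite prod_normE ge_max !le_max.
apply/andP; split; apply/orP; [left|right]; apply: le_trans (norm_le_enorm _) _.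
all: apply: ler_wsqrtr; rewrite -enorm_sqr ler_pdivlMr// mulrC.
all: apply: le_trans pW; rewrite ?lerDl ?lerDr.
all: by rewrite mulr_ge0 ?sqr_ge0 1?ltW.
Qed.

Lemma residual_cvg0 (z zbar : nat -> V * V) :
  residual gamma lx ly (zbar k) (z k) @[k --> \oo] --> 0 ->
  (zbar k - z k) @[k --> \oo] --> (0 : V * V).
Proof.
move=> r0.
suff [d1 d2] : (((zbar k).1 - (z k).1) @[k --> \oo] --> (0 : V)) /\
       (((zbar k).2 - (z k).2) @[k --> \oo] --> (0 : V)).
  exact: cvg_pair d1 d2.
have aux (c : R) (f : nat -> V) : 0 < c ->
    (forall k, c * enorm (f k) ^+ 2 <= residual gamma lx ly (zbar k) (z k)) ->
    f k @[k --> \oo] --> (0 : V).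
  move=> c0 fr; apply: enorm_sqr_cvg0.
  apply: (@squeeze_cvgr _ _ _ _ (cst 0)
    (fun k => c^-1 * residual gamma lx ly (zbar k) (z k))); last 2 first.
  - exact: cvg_cst.
  - by rewrite -[X in _ --> X](mulr0 c^-1); apply: cvgM => //; exact: cvg_cst.
  - near=> k; rewrite sqr_ge0/= -ler_pdivrMl ?invr_gt0//.
    by rewrite invrK.
split; [apply: (aux (gamma * lx))|apply: (aux (gamma^-1 * ly))].
all: rewrite ?mulr_gt0 ?invr_gt0// => k; rewrite /residual ?lerDl ?lerDr.
all: by rewrite mulr_ge0 ?sqr_ge0// mulr_ge0 ?invr_ge0// ltW.
Unshelve. all: end_near. Qed.

Lemma limit_nbhdW eps pstar (z : nat -> V * V) p :
  (forall k, nbhdW X gamma lx ly eps pstar (z k)) ->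
  z k @[k --> \oo] --> p -> nbhdW X gamma lx ly eps pstar p.
Proof.
move=> zW zp.
have z1 : (z k).1 @[k --> \oo] --> p.1 by exact: cvg_comp zp cvg_fst.
have z2 : (z k).2 @[k --> \oo] --> p.2 by exact: cvg_comp zp cvg_snd.
split.
- by apply: limit_memv z1 => k; case: (zW k).
- by apply: limit_memv z2 => k; case: (zW k).
have cvgw : wdist2 gamma lx ly (z k) pstar @[k --> \oo]
    --> wdist2 gamma lx ly p pstar.
  rewrite /wdist2 !enorm_sqr; under eq_fun do rewrite !enorm_sqr.
  apply: cvgD; apply: cvgM; try exact: cvg_cst.
    by apply: cvg_dot; apply: cvgB => //; exact: cvg_cst.
  by apply: cvg_dot; apply: cvgB => //; exact: cvg_cst.
rewrite -(cvg_lim (@Rhausdorff R) cvgw); apply: limr_le; first exact: cvgP cvgw.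
by near=> k; case: (zW k).
Unshelve. all: end_near. Qed.

(** [zbar] shares the limit of [z], so the correction terms vanish and the selected points of the
    graph converge to [p] itself. *)
Lemma limit_link (z zbar : nat -> V * V) p :
  outer_semicontinuous_on S U ->
  (forall k, pd_solution S X U gamma (z k) (zbar k)) ->
  (zbar k - z k) @[k --> \oo] --> (0 : V * V) ->
  z k @[k --> \oo] --> p -> link X S p.
Proof.
move=> osc sol d0 zp.
have zbarp : zbar k @[k --> \oo] --> p.
  have -> : zbar = (fun k => zbar k - z k + z k).
    by apply/funext => k; rewrite subrK.
  by rewrite -[X in _ --> X](add0r p); exact: cvgD.
have z1 : (z k).1 @[k --> \oo] --> p.1 by exact: cvg_comp zp cvg_fst.
have z2 : (z k).2 @[k --> \oo] --> p.2 by exact: cvg_comp zp cvg_snd.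
have zbar1 : (zbar k).1 @[k --> \oo] --> p.1 by exact: cvg_comp zbarp cvg_fst.
have zbar2 : (zbar k).2 @[k --> \oo] --> p.2 by exact: cvg_comp zbarp cvg_snd.
split.
- by apply: limit_memv zbar1 => k; case: (sol k).
- by apply: limit_memv zbar2 => k; case: (sol k).
apply: (osc (fun k => ((zbar k).1 + gamma^-1 *: ((z k).2 - (zbar k).2),
    (zbar k).2 + gamma *: ((z k).1 - (zbar k).1)))).
  by move=> k; case: (sol k).
have -> : p = (p.1 + gamma^-1 *: (p.2 - p.2), p.2 + gamma *: (p.1 - p.1)).
  by rewrite !subrr !scaler0 !addr0; case: p {zp zbarp z1 z2 zbar1 zbar2}.
by apply: (cvg_pair (cvgD zbar1 (cvgZ (cvg_cst gamma^-1) (cvgB z2 zbar2)))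
                  (cvgD zbar2 (cvgZ (cvg_cst gamma) (cvgB z1 zbar1)))).
Qed.

End ProgressiveDecoupling.

(** Compactness gives a cluster point, which must be [p]; a filter living in a compact neighbourhood
    of its only cluster point converges to it. *)
Lemma cvg_of_unique_cluster (R : realType) (n : nat)
    (z : nat -> 'rV[R]_n * 'rV[R]_n) p M :
  (forall k, `|z k - p| <= M) ->
  cluster (z k @[k --> \oo]) `<=` [set p] -> z k @[k --> \oo] --> p.
Proof.
move=> zM zp.
(* Radius [M + 1] rather than [M]: it is positive, so the product of balls is a neighbourhood of
   [p]. *)
have M0 : 0 < M + 1 by rewrite ltr_wpDl// (le_trans _ (zM 0%N)).
have cball (c : 'rV[R]_n) : compact (closed_ball c (M + 1)).
  apply: bounded_closed_compact; last exact: closed_ball_closed.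
  exists (`|c| + (M + 1)); split; first exact: num_real.
  move=> r /ltW rM w; rewrite closed_ballE// /closed_ball_/= => cw.
  apply: le_trans rM; rewrite -[w](subrK c) addrC.
  by rewrite (le_trans (ler_normD _ _))// lerD2l distrC.
have K : compact (closed_ball p.1 (M + 1) `*` closed_ball p.2 (M + 1)).
  by apply: compact_setX; exact: cball.
have zK : (z k @[k --> \oo])
    (closed_ball p.1 (M + 1) `*` closed_ball p.2 (M + 1)).
  exists 0%N => // k _ /=.
  rewrite !closed_ballE//= /closed_ball_/=.
  have := zM k; rewrite prod_normE ge_max => /andP[h1 h2].
  by split; rewrite distrC (le_trans h1, le_trans h2)// lerDl.
apply: (compact_cluster_set1 _ K _ _ zK).
- exact: norm_hausdorff.
- exists (closed_ball p.1 (M + 1), closed_ball p.2 (M + 1)) => //=.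
  by split; apply/nbhs_closedballP; exists (PosNum M0).
- apply/seteqP; split=> // q ->.
  by have [q' [_ /[dup] /zp ->]] := K _ _ zK.
Qed.

(** * The iteration: descent, vanishing residuals, limit points *)

Theorem theorem4p9 (R : realType) (n : nat) (S : 'rV[R]_n -> set 'rV[R]_n)
    (X : {vspace 'rV[R]_n}) (gamma lambdax lambday mu rho : R)
    (xstar ystar : 'rV[R]_n) (U : set ('rV[R]_n * 'rV[R]_n))
    (hstar : link X S (xstar, ystar)) (hstarU : U (xstar, ystar))
    (* (a) *)
    (hmurho : negpart mu * negpart rho < 1)
    (hsemi : semimonotone_at (mu *: orthproj (perp X)) (rho *: orthproj X)
               S (xstar, ystar) U)
    (* (b) *)
    (hosc : outer_semicontinuous_on S U)
    (* (c) *)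
    (hgammal : negpart mu < gamma)
    (hgammau : (gamma%:E < ((negpart rho)%:E)^-1)%E)
    (hlambdax : 0 < lambdax < 2 * (1 + gamma * rho))
    (hlambday : 0 < lambday < 2 * (1 + mu / gamma))
    (* (d) *)
    (eps : R) (heps : 0 < eps)
    (W := nbhdW X gamma lambdax lambday eps (xstar, ystar))
    (hsolv : forall p, W p -> exists pbar, pd_solution S X U gamma p pbar)
    (* iterates *)
    (x y xbar ybar : nat -> 'rV[R]_n)
    (h0 : W (x 0%N, y 0%N))
    (hbar : forall k, pd_solution S X U gamma (x k, y k) (xbar k, ybar k))
    (hx : forall k, x k.+1 = x k + lambdax *: (xbar k - x k))
    (hy : forall k, y k.+1 = y k + lambday *: (ybar k - y k)) :
  let dist2 := fun k =>
    wdist2 gamma lambdax lambday (x k, y k) (xstar, ystar) in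
  let res := fun k =>
    residual gamma lambdax lambday (xbar k, ybar k) (x k, y k) in
  let alphabar :=
    Num.min ((1 + gamma * rho) / lambdax) ((1 + mu / gamma) / lambday) in
  let minres := fun N : nat => \big[Num.min/res 0%N]_(k < N.+1) res k in
  (exists k, (W `&` link X S) (xbar k, ybar k))
  \/
  [/\ (* (i) *)
      (forall k, W (x k, y k)) /\ nonincreasing_seq dist2,
      (* (ii) *)
      [/\ 1 / 2 < alphabar,
          forall N : nat,
            minres N <= dist2 0%N / (N.+1%:R * (2 * alphabar - 1))
        & semimonotone_on (mu *: orthproj (perp X)) (rho *: orthproj X) S U ->
            nonincreasing_seq res /\ forall N : nat, minres N = res N],
      (* (iii) *)
      [/\ bounded_fun (fun k => (x k, y k)),
          bounded_fun (fun k => (xbar k, ybar k)),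
          cluster ((x k, y k) @[k --> \oo]) `<=` W `&` link X S
        & cluster ((xbar k, ybar k) @[k --> \oo]) `<=` W `&` link X S]
    & (* (iv) *)
      [set (xstar, ystar)] = W `&` link X S ->
      exists2 p, (W `&` link X S) p
        & (x k, y k) @[k --> \oo] --> p
          /\ (xbar k, ybar k) @[k --> \oo] --> p].
Proof.
(* The second alternative is established: the estimates hold whether or not a solution has been
   reached. *)
move=> dist2 res alphabar minres; right.
have gamma_gt0 : 0 < gamma.
  by apply: le_lt_trans hgammal; rewrite oppr_ge0 ge_min lexx.
have /andP[lx_gt0 lx_lt] := hlambdax; have /andP[ly_gt0 ly_lt] := hlambday.
have alpha_gt : 1 / 2 < alphabar.
  by rewrite /alphabar lt_min !ltr_pdivlMr//; apply/andP; split; lra.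
have alpha_lx : alphabar * lambdax <= 1 + gamma * rho.
  by rewrite -ler_pdivlMr// ge_min lexx.
have alpha_ly : alphabar * lambday <= 1 + mu / gamma.
  by rewrite -ler_pdivlMr// ge_min lexx orbT.
have c_gt0 : 0 < 2 * alphabar - 1 by lra.
pose z k := (x k, y k); pose zbar k := (xbar k, ybar k).
have zS k : z k.+1 = relax lambdax lambday (z k) (zbar k).
  by rewrite /z hx hy.
have zX k : x k \in X /\ y k \in perp X.
  elim: k => [|k [xX yX]]; first by case: h0.
  case: (hbar k) => /= xbX ybX _.
  by rewrite hx hy; split; rewrite memvD ?memvZ ?memvB.
have dec k : dist2 k.+1 <= dist2 k - (2 * alphabar - 1) * res k.
  have [xX yX] := zX k.
  rewrite /dist2 -/(z k.+1) zS.
  exact: (wdist2_relax (p := z k) gamma_gt0 lx_gt0 ly_gt0 alpha_lx alpha_ly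
    hstar xX yX hsemi (hbar k)).
have res_ge0 k : 0 <= res k by exact: residual_ge0.
have dist2_ge0 k : 0 <= dist2 k by exact: wdist2_ge0.
have dist2_noninc : nonincreasing_seq dist2.
  apply/nonincreasing_seqP => k; apply: le_trans (dec k) _.
  by rewrite gerDl oppr_le0 mulr_ge0// ltW.
have zW k : W (z k).
  have [xX yX] := zX k; split => //.
  by case: h0 => _ _; apply: le_trans; exact: dist2_noninc.
(* By [dec], each residual is at most a constant times a difference of consecutive terms of the
   convergent sequence [dist2]. *)
have res0 : res k @[k --> \oo] --> 0.
  have /cvg_ex[l dl] : cvgn dist2.
    apply: nonincreasing_is_cvgn dist2_noninc _.
    by exists 0 => _ [k _ <-].
  apply: (@squeeze_cvgr _ _ _ _ (cst 0)
      (fun k => (2 * alphabar - 1)^-1 * (dist2 k - dist2 k.+1))); last 2 first.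
  - exact: cvg_cst.
  - rewrite -[X in _ --> X](mulr0 (2 * alphabar - 1)^-1) -(subrr l).
    apply: cvgM; first exact: cvg_cst.
    by apply: cvgB => //; rewrite cvg_shiftS.
  - near=> k; rewrite res_ge0/= -ler_pdivrMl ?invr_gt0// invrK.
    by rewrite lerBrDr -lerBrDl dec.
have zbarz0 : (zbar k - z k) @[k --> \oo] --> (0 : 'rV[R]_n * 'rV[R]_n).
  exact: residual_cvg0 res0.
have limW phi p : phi k @[k --> \oo] --> \oo ->
    z (phi k) @[k --> \oo] --> p -> (W `&` link X S) p.
  move=> phioo zp; split; first by apply: limit_nbhdW zp => //= k; exact: zW.
  apply: (limit_link hosc (fun k => hbar (phi k)) _ zp).
  exact: cvg_comp phioo zbarz0.
have clusterz : cluster (z k @[k --> \oo]) `<=` W `&` link X S.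
  by move=> p /cluster_cvg_subseq[phi phioo zp]; exact: limW phioo zp.
have clusterzbar : cluster (zbar k @[k --> \oo]) `<=` W `&` link X S.
  move=> p /cluster_cvg_subseq[phi phioo zp]; apply: (limW _ _ phioo).
  have -> : (fun k => z (phi k)) =
      (fun k => zbar (phi k) - (zbar (phi k) - z (phi k))).
    by apply/funext => k; rewrite subKr.
  rewrite -[X in _ --> X](subr0 p); apply: cvgB => //.
  exact: cvg_comp phioo zbarz0.
have [M WM] := nbhdW_bounded X gamma_gt0 lx_gt0 ly_gt0 eps (xstar, ystar).
have zM k : `|z k - (xstar, ystar)| <= M by exact: WM (zW k).
have zbounded k : `|z k| <= M + `|(xstar, ystar)|.
  rewrite -[z k](subrK (xstar, ystar)) (le_trans (ler_normD _ _))// lerD2r.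
  exact: zM.
split.
- by split => // k; exact: zW.
- split=> // [N|mono].
    have minres_le j : (j < N.+1)%N -> minres N <= res j.
      by move=> jN; exact: (bigmin_le _ (Ordinal jN)).
    rewrite ler_pdivlMr ?mulr_gt0//.
    (* Telescoping [dec] with [minres N] fixed while [j] grows; at [j = N + 1] the nonnegative
       [dist2 j] is dropped. *)
    suff /(_ N.+1 (leqnn _)) : forall j, (j <= N.+1)%N ->
        minres N * (j%:R * (2 * alphabar - 1)) <= dist2 0%N - dist2 j.
      by move/le_trans; apply; rewrite gerDl oppr_le0.
    elim=> [|j IHj] jN; first by rewrite mul0r mulr0 subrr.
    have := IHj (ltnW jN); have := dec j; have := minres_le _ jN.
    rewrite -natr1 -(ler_pM2l c_gt0).
    lra.
  have res_noninc : nonincreasing_seq res.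
    apply/nonincreasing_seqP => k; have [xX yX] := zX k.
    rewrite /res -/(z k) -/(z k.+1) zS.
    apply: (residual_relax (p := z k) (pbar := zbar k) gamma_gt0 (ltW lx_lt)
      (ltW ly_lt) mono xX yX (hbar k)).
    by rewrite -zS; exact: hbar.
  split=> // N; apply/eqP; rewrite eq_le.
  rewrite (bigmin_le _ (@ord_max N))/=.
  (* The default value [res 0] of the minimum also has to dominate [res N]; monotonicity covers it
     too. *)
  apply: le_bigmin => [|k _]; apply: res_noninc => //.
  by rewrite -ltnS ltn_ord.
- split=> //.
    exists (M + `|(xstar, ystar)|); split; first exact: num_real.
    by move=> r /ltW + k _; apply: le_trans; exact: zbounded.
  (* A convergent sequence is bounded; the bound holds for reals strictly above [D], hence [D + 1]
     below. *)
  have [D [_ DP]] : bounded_fun (fun k => zbar k - z k).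
    by apply: cvg_seq_bounded; apply/cvg_ex; exists 0.
  exists ((D + 1) + (M + `|(xstar, ystar)|)); split; first exact: num_real.
  move=> r /ltW + k _; apply: le_trans.
  rewrite -/(zbar k) -[zbar k](subrK (z k)) (le_trans (ler_normD _ _))//.
  by rewrite lerD// DP// ltrDl.
- move=> Wstar; exists (xstar, ystar); first by rewrite -Wstar.
  have zstar : z k @[k --> \oo] --> (xstar, ystar).
    apply: (@cvg_of_unique_cluster _ _ _ _ M) => [k|]; first exact: zM.
    by rewrite Wstar.
  split=> //.
  have -> : (fun k => (xbar k, ybar k)) = (fun k => (zbar k - z k) + z k).
    by apply/funext => k; rewrite subrK.
  by rewrite -[X in _ --> X](add0r (xstar, ystar)); exact: cvgD.
Unshelve. all: end_near. Qed.
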